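(* Let $\mathcal{C}$ be a Markov category with monoidal unit $I$ in which every kernel $f : X \to Y$ has a Bayesian inverse at every state $p : I \to X$. Then Bayesian inversion defines a functor $T : \mathcal{C} \to \mathbf{BLens}(\mathcal{C})$ up to almost-sure equality. Explicitly: for each kernel $f : X \to Y$ and each state $p : I \to X$ choose a Bayesian inverse $f^\sharp(p) : Y \to X$ of $f$ at $p$, and set $T(X) = \binom{X}{X}$ on objects and $T(f) = (f, f^\sharp) : \binom{X}{X} \to \binom{Y}{Y}$ on kernels. Then $T$ preserves identities and composition up to almost-sure equality of the backward components (the forward components agreeing strictly): for every object $X$ and state $p : I \to X$, $(\mathrm{id}_X)^\sharp(p) \simeq_p \mathrm{id}_X$; and for all composable kernels $f : X \to Y$, $g : Y \to Z$ and every state $p : I \to X$, $$(g \circ f)^\sharp(p) \;\simeq_{g \circ f \circ p}\; f^\sharp(p) \circ g^\sharp(f \circ p).$$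
   Context: A Markov category is a symmetric monoidal category $(\mathcal{C}, \otimes, I)$ in which every object $X$ carries a commutative comonoid structure $\mathrm{copy}_X : X \to X \otimes X$, $\mathrm{delete}_X : X \to I$, such that the maps $\mathrm{delete}_X$ are natural in $X$, and the copy maps are compatible with the monoidal structure ($\mathrm{copy}_{X \otimes Y}$ is $\mathrm{copy}_X \otimes \mathrm{copy}_Y$ followed by the symmetry exchanging the two middle factors). Morphisms of $\mathcal{C}$ are called kernels; a morphism $p : I \to X$ is called a state on $X$. Almost-sure equality: for $p : I \to X$ and $f, g : X \to Y$, write $f \simeq_p g$ if $(f \otimes \mathrm{id}_X) \circ \mathrm{copy}_X \circ p = (g \otimes \mathrm{id}_X) \circ \mathrm{copy}_X \circ p$. Bayesian inverse: for $f : X \to Y$ and $p : I \to X$, a kernel $f' : Y \to X$ is a Bayesian inverse of $f$ at $p$ if $(f' \otimes \mathrm{id}_Y) \circ \mathrm{copy}_Y \circ f \circ p = (\mathrm{id}_X \otimes f) \circ \mathrm{copy}_X \circ p$. Bayesian lenses: $\mathbf{BLens}(\mathcal{C})$ is the category whose objects are pairs $\binom{X}{A}$ of objects of $\mathcal{C}$, and whose morphisms $\binom{X}{A} \to \binom{Y}{B}$ are pairs $(f, f^\sharp)$ with $f : X \to Y$ a kernel and $f^\sharp : \mathcal{C}(I, X) \to \mathcal{C}(B, A)$ a function. The composite of $(f, f^\sharp) : \binom{X}{A} \to \binom{Y}{B}$ and $(g, g^\sharp) : \binom{Y}{B} \to \binom{Z}{C}$ has forward component $g \circ f$ and backward component $p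 \mapsto f^\sharp(p) \circ g^\sharp(f \circ p) : C \to A$. The identity on $\binom{X}{A}$ is $(\mathrm{id}_X, p \mapsto \mathrm{id}_A)$. *)

(* Defs.v *)
From Stdlib Require Import ssreflect FunctionalExtensionality.

Set Implicit Arguments.
Unset Strict Implicit.
Unset Printing Implicit Defensive.

Reserved Notation "X ~> Y" (at level 90, no associativity).
Reserved Notation "g ∘ f" (at level 40, left associativity).
Reserved Notation "X ⊗ Y" (at level 38, left associativity).
Reserved Notation "f ⊗₁ g" (at level 38, left associativity).
Reserved Notation "f ≃[ p ] g" (at level 70, p at level 50, no associativity).

Record Category := {
  Ob :> Type;
  Hom : Ob -> Ob -> Type where "X ~> Y" := (Hom X Y);
  ident : forall X, X ~> X;
  comp : forall X Y Z, (Y ~> Z) -> (X ~> Y) -> (X ~> Z)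
    where "g ∘ f" := (comp g f);
  comp_identl : forall X Y (f : X ~> Y), ident Y ∘ f = f;
  comp_identr : forall X Y (f : X ~> Y), f ∘ ident X = f;
  comp_assoc : forall W X Y Z (h : Y ~> Z) (g : X ~> Y) (f : W ~> X),
    h ∘ (g ∘ f) = (h ∘ g) ∘ f
}.

Arguments ident {_} X.

Notation "X ~> Y" := (Hom X Y).
Notation "g ∘ f" := (comp g f).

(* The monoidal structure is not assumed strict: [assoc], [lunit], [runit] are
   the structural isomorphisms, given together with their inverses. *)
Record SymMonCategory := {
  smc_cat :> Category;
  munit : smc_cat;
  tensor : smc_cat -> smc_cat -> smc_cat
    where "X ⊗ Y" := (tensor X Y);
  tensorf : forall X X' Y Y' : smc_cat,
    (X ~> X') -> (Y ~> Y') -> (X ⊗ Y ~> X' ⊗ Y')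
    where "f ⊗₁ g" := (tensorf f g);
  tensorf_ident : forall X Y : smc_cat, ident X ⊗₁ ident Y = ident (X ⊗ Y);
  tensorf_comp : forall (X X' X'' Y Y' Y'' : smc_cat)
      (f' : X' ~> X'') (f : X ~> X') (g' : Y' ~> Y'') (g : Y ~> Y'),
    (f' ∘ f) ⊗₁ (g' ∘ g) = (f' ⊗₁ g') ∘ (f ⊗₁ g);

  assoc : forall X Y Z : smc_cat, (X ⊗ Y) ⊗ Z ~> X ⊗ (Y ⊗ Z);
  assocV : forall X Y Z : smc_cat, X ⊗ (Y ⊗ Z) ~> (X ⊗ Y) ⊗ Z;
  lunit : forall X : smc_cat, munit ⊗ X ~> X;
  lunitV : forall X : smc_cat, X ~> munit ⊗ X;
  runit : forall X : smc_cat, X ⊗ munit ~> X;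
  runitV : forall X : smc_cat, X ~> X ⊗ munit;
  braid : forall X Y : smc_cat, X ⊗ Y ~> Y ⊗ X;

  assocK : forall X Y Z, assocV X Y Z ∘ assoc X Y Z = ident _;
  assocVK : forall X Y Z, assoc X Y Z ∘ assocV X Y Z = ident _;
  lunitK : forall X, lunitV X ∘ lunit X = ident _;
  lunitVK : forall X, lunit X ∘ lunitV X = ident _;
  runitK : forall X, runitV X ∘ runit X = ident _;
  runitVK : forall X, runit X ∘ runitV X = ident _;
  braidK : forall X Y, braid Y X ∘ braid X Y = ident _;

  assoc_nat : forall (X X' Y Y' Z Z' : smc_cat)
      (f : X ~> X') (g : Y ~> Y') (h : Z ~> Z'),
    assoc X' Y' Z' ∘ ((f ⊗₁ g) ⊗₁ h) = (f ⊗₁ (g ⊗₁ h)) ∘ assoc X Y Z;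
  lunit_nat : forall (X X' : smc_cat) (f : X ~> X'),
    lunit X' ∘ (ident munit ⊗₁ f) = f ∘ lunit X;
  runit_nat : forall (X X' : smc_cat) (f : X ~> X'),
    runit X' ∘ (f ⊗₁ ident munit) = f ∘ runit X;
  braid_nat : forall (X X' Y Y' : smc_cat) (f : X ~> X') (g : Y ~> Y'),
    braid X' Y' ∘ (f ⊗₁ g) = (g ⊗₁ f) ∘ braid X Y;

  pentagon : forall W X Y Z : smc_cat,
    assoc W X (Y ⊗ Z) ∘ assoc (W ⊗ X) Y Z
    = (ident W ⊗₁ assoc X Y Z) ∘ assoc W (X ⊗ Y) Z
        ∘ (assoc W X Y ⊗₁ ident Z);
  triangle : forall X Y : smc_cat,
    (ident X ⊗₁ lunit Y) ∘ assoc X munit Y = runit X ⊗₁ ident Y;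
  hexagon : forall X Y Z : smc_cat,
    assoc Y Z X ∘ braid X (Y ⊗ Z) ∘ assoc X Y Z
    = (ident Y ⊗₁ braid X Z) ∘ assoc Y X Z ∘ (braid X Y ⊗₁ ident Z)
}.

Arguments munit {_}.
Arguments assoc {_} X Y Z.
Arguments assocV {_} X Y Z.
Arguments lunit {_} X.
Arguments lunitV {_} X.
Arguments runit {_} X.
Arguments runitV {_} X.
Arguments braid {_} X Y.

Notation "X ⊗ Y" := (tensor X Y).
Notation "f ⊗₁ g" := (tensorf f g).

Definition middle_swap (C : SymMonCategory) (W X Y Z : C) :
    (W ⊗ X) ⊗ (Y ⊗ Z) ~> (W ⊗ Y) ⊗ (X ⊗ Z) :=
  assocV W Y (X ⊗ Z)
    ∘ (ident W ⊗₁ (assoc Y X Z ∘ (braid X Y ⊗₁ ident Z) ∘ assocV X Y Z))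
    ∘ assoc W X (Y ⊗ Z).

Arguments middle_swap {C} W X Y Z.

(* [delete_nat] is naturality of [delete] as a transformation from the identity
   functor to the constant functor at [munit].  With the counit laws it makes
   [munit] terminal, so compatibility of [delete] with the tensor, and of both
   maps with [munit], need not be postulated. *)
Record MarkovCategory := {
  markov_smc :> SymMonCategory;
  copy : forall X : markov_smc, X ~> X ⊗ X;
  delete : forall X : markov_smc, X ~> munit;
  copy_assoc : forall X,
    assoc X X X ∘ (copy X ⊗₁ ident X) ∘ copy X
    = (ident X ⊗₁ copy X) ∘ copy X;
  copy_deletel : forall X, lunit X ∘ (delete X ⊗₁ ident X) ∘ copy X = ident X;
  copy_deleter : forall X, runit X ∘ (ident X ⊗₁ delete X) ∘ copy X = ident X;
  copy_comm : forall X, braid X X ∘ copy X = copy X;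
  delete_nat : forall (X Y : markov_smc) (f : X ~> Y), delete Y ∘ f = delete X;
  copy_tensor : forall X Y,
    copy (X ⊗ Y) = middle_swap X X Y Y ∘ (copy X ⊗₁ copy Y)
}.

Arguments copy {_} X.
Arguments delete {_} X.

Definition state (C : MarkovCategory) (X : C) : Type := munit ~> X.

Definition as_eq (C : MarkovCategory) (X Y : C) (p : state X)
    (f g : X ~> Y) : Prop :=
  (f ⊗₁ ident X) ∘ copy X ∘ p = (g ⊗₁ ident X) ∘ copy X ∘ p.

Notation "f ≃[ p ] g" := (as_eq p f g).

Definition is_bayes_inverse (C : MarkovCategory) (X Y : C)
    (f : X ~> Y) (p : state X) (f' : Y ~> X) : Prop :=
  (f' ⊗₁ ident Y) ∘ copy Y ∘ f ∘ p = (ident X ⊗₁ f) ∘ copy X ∘ p.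

(* Objects of [BLens C] are pairs (X, A), with X the forward and A the backward
   component. *)
Record lens (C : MarkovCategory) (P Q : C * C) := Lens {
  fwd : fst P ~> fst Q;
  bwd : state (fst P) -> (snd Q ~> snd P)
}.

Definition lens_ident (C : MarkovCategory) (P : C * C) : lens P P :=
  Lens (ident (fst P)) (fun _ => ident (snd P)).

Definition lens_comp (C : MarkovCategory) (P Q S : C * C)
    (G : lens Q S) (F : lens P Q) : lens P S :=
  Lens (fwd G ∘ fwd F) (fun p => bwd F p ∘ bwd G (fwd F ∘ p)).

Lemma lens_comp_identl (C : MarkovCategory) (P Q : C * C) (F : lens P Q) :
  lens_comp (lens_ident Q) F = F.
Proof.
case: F => f b; rewrite /lens_comp /=; congr Lens; first exact: comp_identl.
by apply: functional_extensionality => p; exact: comp_identr.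
Qed.

Lemma lens_comp_identr (C : MarkovCategory) (P Q : C * C) (F : lens P Q) :
  lens_comp F (lens_ident P) = F.
Proof.
case: F => f b; rewrite /lens_comp /=; congr Lens; first exact: comp_identr.
by apply: functional_extensionality => p; rewrite !comp_identl.
Qed.

Lemma lens_comp_assoc (C : MarkovCategory) (P Q S U : C * C)
    (H : lens S U) (G : lens Q S) (F : lens P Q) :
  lens_comp H (lens_comp G F) = lens_comp (lens_comp H G) F.
Proof.
rewrite /lens_comp /=; congr Lens; first exact: comp_assoc.
by apply: functional_extensionality => p; rewrite !comp_assoc.
Qed.

Definition BLens (C : MarkovCategory) : Category := {|
  Ob := (C * C)%type;
  Hom := @lens C;
  ident := @lens_ident C;
  comp := @lens_comp C;
  comp_identl := @lens_comp_identl C;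
  comp_identr := @lens_comp_identr C;
  comp_assoc := @lens_comp_assoc C
|}.

Definition has_bayes_inverses (C : MarkovCategory) : Prop :=
  forall (X Y : C) (f : X ~> Y) (p : state X),
  exists f' : Y ~> X, is_bayes_inverse f p f'.

Definition kernel_inversion (C : MarkovCategory) : Type :=
  forall X Y : C, (X ~> Y) -> state X -> (Y ~> X).

Definition is_bayes_inversion (C : MarkovCategory)
    (inv : kernel_inversion C) : Prop :=
  forall (X Y : C) (f : X ~> Y) (p : state X),
  is_bayes_inverse f p (inv X Y f p).

Definition T_ob (C : MarkovCategory) (X : C) : BLens C := (X, X).

Definition T_map (C : MarkovCategory) (inv : kernel_inversion C) (X Y : C)
    (f : X ~> Y) : T_ob X ~> T_ob Y :=
  @Lens C (X, X) (Y, Y) f (inv X Y f).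

(* Main.v *)
Require Import Defs.
From Stdlib Require Import ssreflect IndefiniteDescription.

(** A Bayesian inverse [f'] of [f] at [p] is specified by an equation whose
    left-hand side is the very expression that almost-sure equality at the
    pushforward state [f ∘ p] compares.  Two Bayesian inverses of [f] at [p] are
    therefore almost surely equal at [f ∘ p] ([bayes_inverse_unique]), so an
    almost-sure equation between backward components holds as soon as both sides
    are Bayesian inverses of the same kernel at the same state.

    Functoriality then reduces to two facts about Bayesian inverses: the identity
    inverts the identity ([bayes_inverse_ident]), and inverting two kernels in
    succession inverts their composite ([bayes_inverse_comp]).  In the
    second one, [g'] turns the copied state on [Z] into the joint law of [Y] and
    [Z], that is, the copied state on [Y] with [g] run on the right factor.  Since
    [f'] acts on the left factor it commutes with [g], so it meets the copied
    state on [Y], where it turns it into the joint law of [X] and [Y]; running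
    [g] on the right then gives the joint law of [X] and [Z]. *)

Section BayesInverses.

Variable C : MarkovCategory.

(** Interchange law: maps acting on different tensor factors commute. *)
Lemma tensorf_swap (X X' Y Y' : C) (f : X ~> X') (g : Y ~> Y') :
  (f ⊗₁ ident Y') ∘ (ident X ⊗₁ g) = (ident X' ⊗₁ g) ∘ (f ⊗₁ ident Y).
Proof. by rewrite -!tensorf_comp !comp_identl !comp_identr. Qed.

(** The joint law on the right of the defining equation does not mention the
    inverse, so it is shared by all the inverses of [f] at [p]. *)
Lemma bayes_inverse_unique (X Y : C) (f : X ~> Y) (p : state X)
    (f1 f2 : Y ~> X) :
  is_bayes_inverse f p f1 -> is_bayes_inverse f p f2 -> f1 ≃[f ∘ p] f2.
Proof. by rewrite /is_bayes_inverse /as_eq !comp_assoc => -> ->. Qed.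

Lemma bayes_inverse_ident (X : C) (p : state X) :
  is_bayes_inverse (ident X) p (ident X).
Proof. by rewrite /is_bayes_inverse comp_identr. Qed.

(** The kernel [g] is inverted at the pushforward [f ∘ p], the state that reaches
    it when [f] is run on [p]; this is what the composition of lenses feeds to
    the backward component of [g]. *)
Lemma bayes_inverse_comp (X Y Z : C) (f : X ~> Y) (g : Y ~> Z) (p : state X)
    (f' : Y ~> X) (g' : Z ~> Y) :
  is_bayes_inverse f p f' -> is_bayes_inverse g (f ∘ p) g' ->
  is_bayes_inverse (g ∘ f) p (f' ∘ g').
Proof.
rewrite /is_bayes_inverse => Hf Hg.
have -> : (f' ∘ g') ⊗₁ ident Z = (f' ⊗₁ ident Z) ∘ (g' ⊗₁ ident Z).
  by rewrite -tensorf_comp comp_identl.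
have -> : ident X ⊗₁ (g ∘ f) = (ident X ⊗₁ g) ∘ (ident X ⊗₁ f).
  by rewrite -tensorf_comp comp_identl.
rewrite -!comp_assoc in Hf Hg *.
by rewrite Hg comp_assoc tensorf_swap -comp_assoc Hf.
Qed.

(** Mere existence of inverses gives a choice of them as a function only through
    a description principle, since kernels form arbitrary types. *)
Lemma bayes_inversion_exists :
  has_bayes_inverses C ->
  exists inv : kernel_inversion C, is_bayes_inversion inv.
Proof.
move=> H.
pose chosen X Y f p := constructive_indefinite_description _ (H X Y f p).
exists (fun X Y f p => proj1_sig (chosen X Y f p)) => X Y f p.
exact: proj2_sig.
Qed.

End BayesInverses.

Theorem proposition11 :
  forall C : MarkovCategory,
  has_bayes_inverses C ->
  (exists inv : kernel_inversion C, is_bayes_inversion inv) /\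
  (forall inv : kernel_inversion C, is_bayes_inversion inv ->
    (forall X : C,
       fwd (T_map inv (ident X)) = fwd (ident (T_ob X)) /\
       forall p : state X,
         bwd (T_map inv (ident X)) p ≃[p] bwd (ident (T_ob X)) p) /\
    (forall (X Y Z : C) (f : X ~> Y) (g : Y ~> Z),
       fwd (T_map inv (g ∘ f)) = fwd (T_map inv g ∘ T_map inv f) /\
       forall p : state X,
         bwd (T_map inv (g ∘ f)) p
           ≃[g ∘ f ∘ p] bwd (T_map inv g ∘ T_map inv f) p)).
Proof.
move=> C H; split; first exact: bayes_inversion_exists.
move=> inv Hinv; split=> [X | X Y Z f g]; split=> //= p.
- (* uniqueness compares at [ident X ∘ p], which is [p] *)
  rewrite -{1}(comp_identl p).
  exact: bayes_inverse_unique (Hinv _ _ _ _) (bayes_inverse_ident _ _ _).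
- apply: bayes_inverse_unique; first exact: Hinv.
  by apply: bayes_inverse_comp; exact: Hinv.
Qed.
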